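(* Let $\mathcal{H}$ be a real Hilbert space and let $A,B:\mathcal{H}\rightrightarrows\mathcal{H}$ be maximal monotone operators. Let $T:\mathcal{H}\rightrightarrows\mathcal{H}$ be the extended sum of $A$ and $B$, i.e. $Tx=\bigcap_{\varepsilon>0}\overline{A^{\varepsilon}x+B^{\varepsilon}x}$ for all $x\in\mathcal{H}$, and assume that $T$ is maximal monotone and that the set $\mathcal{S}=\{x\in\mathcal{H}: 0\in Tx\}$ is nonempty. Assume $\mathrm{D}(A)\subset\bigcap_{\varepsilon>0}\mathrm{D}(B^{\varepsilon})$. Let $(\lambda_n)_{n\ge 0}$ and $(\varepsilon_n)_{n\ge 0}$ be any sequences of positive real numbers satisfying $$\sum\lambda_n=\infty,\qquad \sum\lambda_n^{4/3}<\infty,\qquad \varepsilon_n=\lambda_n^{1/3}\ \text{ for all } n.$$ Let $(x_n)_{n\ge0}$ be a sequence generated by the extended forward-backward algorithm, that is, $x_0\in\mathrm{D}(B^{\varepsilon_0})$ and, for all $n\in\mathbb{N}$ (including $n=0$), $$x_{n+1}=(I+\lambda_nA)^{-1}(x_n-\lambda_nu_n)\quad\text{with } u_n\in B^{\varepsilon_n}x_n.$$ Assume further that: (1) the sequence $(\varepsilon_nu_n)$ is bounded; (2) for every $x\in\mathcal{S}$ there is $M>0$ such that $0\in\bigcap_{n}\overline{A^{\varepsilon_n}x+\bigl(B^{\varepsilon_n}x\cap (M/\varepsilon_n)B_{\mathcal{H}}\bigr)}$, where $B_{\mathcal{H}}$ is the unit ball of $\mathcal{H}$. Then the sequence $(\bar{x}_n)_{n\ge1}$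 of weighted averages $$\bar{x}_n=\frac{1}{\sigma_n}\sum_{k=1}^n\lambda_kx_k,\qquad \sigma_n=\sum_{k=1}^n\lambda_k,$$ converges weakly to a point in $\mathcal{S}$.
   Context: A set-valued operator $T:\mathcal{H}\rightrightarrows\mathcal{H}$ is identified with its graph, a subset of $\mathcal{H}\times\mathcal{H}$; its domain is $\mathrm{D}(T)=\{x\in\mathcal{H}:Tx\neq\emptyset\}$. It is monotone if $\langle v-u,y-x\rangle\ge0$ for all $(x,u),(y,v)\in T$, and maximal monotone if it is monotone and maximal under inclusion among monotone subsets of $\mathcal{H}\times\mathcal{H}$. For $A$ maximal monotone and $\lambda>0$, the resolvent $(I+\lambda A)^{-1}$ is a single-valued map defined on all of $\mathcal{H}$ (Minty), where $I$ is the identity. For a monotone operator $T$ and $\varepsilon\ge0$, the $\varepsilon$-enlargement $T^{\varepsilon}:\mathcal{H}\rightrightarrows\mathcal{H}$ is defined by $$T^{\varepsilon}x=\{u\in\mathcal{H}:\langle v-u,y-x\rangle\ge-\varepsilon\ \ \forall (y,v)\in T\}.$$ The sum of two subsets of $\mathcal{H}$ is the Minkowski sum, and the overline denotes closure in $\mathcal{H}$ for the norm topology. *)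

(* Defs.v *)
From HB Require Import structures.
From mathcomp Require Import all_boot all_order all_algebra.
From mathcomp Require Import all_classical all_reals all_analysis.

Set Implicit Arguments.
Unset Strict Implicit.
Unset Printing Implicit Defensive.

Import Order.TTheory GRing.Theory Num.Theory.
Import numFieldNormedType.Exports.

Local Open Scope classical_set_scope.
Local Open Scope ring_scope.

Section Operators.
Variables (R : realType) (H : completeNormedModType R).

(* With [H] complete, this makes [H] a real Hilbert space. *)
Definition norm_of_dot (dot : {dot H for @idfun R}) : Prop :=
  forall x : H, `|x| = Num.sqrt (dot x x).

Variable dot : {dot H for @idfun R}.

(* Set-valued operators are functions [H -> set H]; [T x u] reads [u \in T x]. *)
Implicit Types T A B : H -> set H.

Definition graph T : set (H * H) := [set p | T p.1 p.2].

Definition domain T : set H := [set x | T x !=set0].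

Definition monotone (G : set (H * H)) : Prop :=
  forall x u y v, G (x, u) -> G (y, v) -> 0 <= dot (v - u) (y - x).

Definition maximal_monotone T : Prop :=
  monotone (graph T) /\
  forall G : set (H * H), monotone G -> graph T `<=` G -> G = graph T.

Definition enlargement T (eps : R) : H -> set H := fun x =>
  [set u | forall y v, graph T (y, v) -> - eps <= dot (v - u) (y - x)].

Definition minkowski_sum (X Y : set H) : set H :=
  [set a + b | a in X & b in Y].

Definition extended_sum A B : H -> set H := fun x =>
  \bigcap_(eps in [set e : R | 0 < e])
    closure (minkowski_sum (enlargement A eps x) (enlargement B eps x)).

Definition zeros T : set H := [set x | T x 0].

Definition inverse T : H -> set H := fun y => [set x | T x y].

(* [(I + lam A)^-1] as an operator. For [A] maximal monotone and [lam > 0] its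
   values are singletons, so that [x = (I + lam A)^-1 z] is stated as
   [resolvent A lam z x]. *)
Definition resolvent A (lam : R) : H -> set H :=
  inverse (fun x => [set x + lam *: a | a in A x]).

Definition scaled_unit_ball (r : R) : set H :=
  [set r *: z | z in [set z : H | `|z| <= 1]].

Definition weighted_average (lam : nat -> R) (x : nat -> H) (n : nat) : H :=
  (\sum_(1 <= k < n.+1) lam k)^-1 *: \sum_(1 <= k < n.+1) lam k *: x k.

(* [R^o] is [R] seen as a module over itself. *)
Definition converges_weakly_to (x : nat -> H) (l : H) : Prop :=
  forall f : {linear H -> R^o}, continuous f -> f (x n) @[n --> \oo] --> f l.

Lemma resolvent_unique A (lam : R) z x y : monotone (graph A) -> 0 < lam ->
  resolvent A lam z x -> resolvent A lam z y -> x = y.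
Proof.
move=> monA lam0 [a Aa <-] [b Ab eba].
have xy : x - y = lam *: (b - a).
  rewrite scalerBr; apply/eqP; rewrite subr_eq addrAC eq_sym subr_eq.
  by rewrite addrC eba.
have mon := monA _ _ _ _ Ab Aa.
apply/eqP; rewrite -subr_eq0; apply/negPn/negP => /[dup] xyN0.
move=> /(neq0_dnorm_gt0 (s := dot)); rewrite {1}xy linearZl_LR/= => h.
have : 0 < dot (b - a) (x - y) by rewrite -(pmulr_rgt0 _ lam0).
by rewrite -opprB linearNl oppr_gt0 ltNge mon.
Qed.

End Operators.

Arguments scaled_unit_ball {R H} r.

(* Main.v *)
Require Import Defs.
From HB Require Import structures.
From mathcomp Require Import all_boot all_order all_algebra.
From mathcomp Require Import all_classical all_reals all_analysis.
From mathcomp Require Import ring lra.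

(** The averages converge by an Opial-type argument, fed by one inequality for a
    step of the algorithm.

    Two elements [u] of [B^e x] and [v] of [B^d y] are almost monotonically
    related, [dot (u - v) (x - y) >= - 2 (e + d)], because [B] is maximal
    ([enlargement_almost_monotone]). Hence, for [a] in [A^d y] and [b] in [B^d y],
    a step satisfies ([forward_backward_step])
    [|x' - y|^2 <= |x - y|^2 - 2 lam <a + b, x - y> + lam^2 |u + a|^2
                   + lam (4 e + 6 d)].
    As [lam_n = eps_n^3] and [eps_n u_n] is bounded, the error terms are of order
    [eps_n^4 = lam_n^(4/3)], which is summable. The inequality is used twice.

    For [y = z] a zero of [T], the second assumption on the algorithm allows
    [a + b] to be as small as desired while [eps_n a] stays bounded, so that
    [|x_(n+1) - z|^2 <= |x_n - z|^2 + K eps_n^4] ([quasi_fejer]). Therefore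
    [|x_n - z|] converges for every zero [z], and [x_n] is bounded.

    For [(y, v)] in the graph of [T], [v] is approximated by sums [a + b] with [a]
    in [A^d y] and [b] in [B^d y]; summing the inequality and dividing by the sum
    of the weights, which diverges, gives
    [limsup <v, xbar_n - y> <= 0] ([weighted_average_related]). By maximality of
    [T], every weak limit of the averages is thus a zero of [T].

    Finally, for two zeros [z1], [z2] the sequence [<x_n, z1 - z2>] converges, and
    so does its weighted mean [<xbar_n, z1 - z2>] ([weighted_mean_cvg]). This
    forces all weak limits to coincide ([weak_cvg_of_unique_ultralimits]). Weak
    limits are taken along ultrafilters on the indices; they exist by the Riesz
    representation of the limit functional ([weak_ultralimit]). *)

Set Implicit Arguments.
Unset Strict Implicit.
Unset Printing Implicit Defensive.

Import Order.TTheory GRing.Theory Num.Theory.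
Import numFieldNormedType.Exports.

Local Open Scope classical_set_scope.
Local Open Scope ring_scope.

(** * Inner products and the Riesz representation *)

Section InnerProduct.
Context {R : realType} {H : completeNormedModType R}.
Variables (dot : {dot H for @idfun R}) (hilbert : norm_of_dot dot).
Implicit Types x y z : H.

Lemma dotC x y : dot x y = dot y x.
Proof. by rewrite hermC expr0 mul1r. Qed.

Lemma dotZl (c : R) x y : dot (c *: x) y = c * dot x y.
Proof. by rewrite linearZl_LR. Qed.

Lemma dotZr (c : R) x y : dot x (c *: y) = c * dot x y.
Proof. by rewrite linearZr_LR. Qed.

Lemma dotDl x y z : dot (x + y) z = dot x z + dot y z.
Proof. exact: linearDl. Qed.

Lemma dotDr x y z : dot x (y + z) = dot x y + dot x z.
Proof. exact: linearDr. Qed.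

Lemma dotBl x y z : dot (x - y) z = dot x z - dot y z.
Proof. exact: linearBl. Qed.

Lemma dotBr x y z : dot x (y - z) = dot x y - dot x z.
Proof. exact: linearBr. Qed.

(** Rewriting base that expands the form on linear combinations, so that
    inequalities between inner products are left to linear arithmetic. *)
Definition dotE := (dotBl, dotBr, dotDl, dotDr, dotZl, dotZr).

Lemma sqr_norm_dot x : `|x| ^+ 2 = dot x x.
Proof.
rewrite hilbert sqr_sqrtr//; have [->|x0] := eqVneq x 0.
  by rewrite linear0l.
by rewrite ltW// neq0_dnorm_gt0.
Qed.

Lemma sqr_normD x y : `|x + y| ^+ 2 = `|x| ^+ 2 + 2 * dot x y + `|y| ^+ 2.
Proof. by rewrite !sqr_norm_dot linearDl !linearDr/= (dotC y x); ring. Qed.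

Lemma sqr_normB x y : `|x - y| ^+ 2 = `|x| ^+ 2 - 2 * dot x y + `|y| ^+ 2.
Proof. by rewrite sqr_normD normrN linearNr/=; ring. Qed.

Lemma dot_le_norm x y : dot x y <= `|x| * `|y|.
Proof.
have [x0|] := eqVneq `|x| 0.
  by move/normr0_eq0: x0 => ->; rewrite linear0l normr0 mul0r.
have [y0|] := eqVneq `|y| 0.
  by move/normr0_eq0: y0 => ->; rewrite linear0r normr0 mulr0.
move=> y0 x0.
have := sqr_ge0 `| `|y| *: x - `|x| *: y|.
rewrite sqr_normB !normrZ !normr_id dotZl dotZr => h.
have xy0 : 0 < `|x| * `|y| by rewrite mulr_gt0// lt_def normr_ge0 ?x0 ?y0.
rewrite -(ler_pM2l xy0); nra.
Qed.

Lemma normr_dot_le x y : `|dot x y| <= `|x| * `|y|.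
Proof.
by rewrite ler_norml dot_le_norm lerNl -linearNl/= -(normrN x) dot_le_norm.
Qed.

(** The representing vector is the minimiser of [J x = `|x| ^+ 2 - 2 * f x]. By
    the parallelogram law two near-minimisers of [J] are close to each other, so
    that the sublevel sets of [J] generate a Cauchy filter; and comparing [J] at
    a near-minimiser [x] with [J] on the line through [x] directed by [h] shows
    that [dot x h] is close to [f h], which passes to the limit. *)
Lemma riesz_representation (f : H -> R) (C : R)
    (fD : forall x y, f (x + y) = f x + f y)
    (fZ : forall (c : R) x, f (c *: x) = c * f x)
    (fC : forall x, `|f x| <= C * `|x|) :
  exists w, forall h, f h = dot w h.
Proof.
pose J x := `|x| ^+ 2 - 2 * f x.
pose m := inf (range J).
have J_lb : lbound (range J) (- C ^+ 2).
  move=> _ [x _ <-]; rewrite /J.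
  have := fC x; rewrite ler_norml => /andP[_ h].
  have := sqr_ge0 (`|x| - C); nra.
have J_ge x : m <= J x by apply: ge_inf; [exists (- C ^+ 2)|exists x].
have J_lt e : 0 < e -> exists x, J x < m + e.
  move=> e0; have [|_ [x _ <-] xe] := @inf_adherent _ (range J) e e0.
    by split; [exists (J 0), 0|exists (- C ^+ 2)].
  by exists x.
have parallelogram x y : `|x - y| ^+ 2 <= 2 * (J x - m) + 2 * (J y - m).
  have := J_ge (2^-1 *: (x + y)).
  rewrite /J normrZ exprMn sqr_normB sqr_normD fZ fD.
  rewrite (@ger0_norm _ (2^-1))// => h; nra.
have near_min x e h : 0 <= e -> J x <= m + e ^+ 2 ->
    `|dot x h - f h| <= e * `|h|.
  move=> e0 xe; set g := dot x h - f h.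
  have [h0|h0] := eqVneq `|h| 0.
    move/normr0_eq0: h0 => h0; rewrite /g h0 linear0r normr0 mulr0.
    by have := fC 0; rewrite normr0 mulr0 add0r normrN.
  have h_gt0 : 0 < `|h| by rewrite lt_def h0 normr_ge0.
  (* This point minimises J on the line through x directed by h. *)
  have := J_ge (x + (- g / `|h| ^+ 2) *: h).
  rewrite /J sqr_normD dotZr normrZ exprMn real_normK ?num_real// fD fZ.
  have -> : `|x| ^+ 2 + 2 * (- g / `|h| ^+ 2 * dot x h) +
     (- g / `|h| ^+ 2) ^+ 2 * `|h| ^+ 2 - 2 * (f x + - g / `|h| ^+ 2 * f h)
     = J x - g ^+ 2 / `|h| ^+ 2.
    by rewrite /J /g; field.
  move=> h1.
  have h2 : g ^+ 2 / `|h| ^+ 2 <= e ^+ 2 by lra.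
  rewrite ler_pdivrMr ?exprn_gt0// in h2.
  rewrite -(@ler_pXn2r _ 2)// ?nnegrE ?mulr_ge0// real_normK ?num_real//.
  by rewrite exprMn.
pose F := filter_from [set e : R | 0 < e] (fun e => [set x | J x <= m + e]).
have FF : ProperFilter F.
  apply: filter_from_proper; last first.
    by move=> e /J_lt[x /ltW xe]; exists x.
  apply: filter_from_filter; first by exists 1; rewrite /= ltr01.
  move=> d e /= d0 e0; exists (Num.min d e); first by rewrite /= lt_min d0.
  move=> x /= xde; split=> /=; rewrite (le_trans xde)// lerD2l ge_min lexx//.
  by rewrite orbT.
have : cvg F.
  apply: cauchy_cvg; apply: cauchy_exP => e e0.
  have d0 : 0 < e ^+ 2 / 8 by rewrite divr_gt0// exprn_gt0.
  have [p pe] := J_lt _ d0; exists p; exists (e ^+ 2 / 8) => //= x xe.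
  rewrite -ball_normE/= -(@ltr_pXn2r _ 2)// ?nnegrE// 1?ltW//.
  apply: (le_lt_trans (parallelogram _ _)).
  have : 0 < e ^+ 2 by rewrite exprn_gt0.
  rewrite /= in xe.
  lra.
move=> /cvg_ex[w Fw]; exists w => h; apply/eqP.
rewrite eq_sym -subr_eq0 -normr_le0; apply/ler_addgt0Pl => e e0; rewrite addr0.
pose d := e / (2 * (`|h| + 1)).
have h1 : 0 < `|h| + 1 by rewrite ltr_wpDl.
have d0 : 0 < d by rewrite divr_gt0// mulr_gt0.
have dh : 2 * (d * `|h|) <= e.
  have -> : e = 2 * (d * (`|h| + 1)) by rewrite /d; field; rewrite gt_eqF.
  by rewrite ler_pM2l// ler_pM2l// lerDl.
have [] := @filter_ex _ F FF (ball w d `&` [set x | J x <= m + d ^+ 2]).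
  apply: filterI; first by apply: Fw; exact: nbhsx_ballx.
  by exists (d ^+ 2) => //=; rewrite exprn_gt0.
move=> x [/=]; rewrite -ball_normE/= => wx /near_min => /(_ h (ltW d0)) xh.
have -> : dot w h - f h = dot (w - x) h + (dot x h - f h).
  by rewrite linearBl/=; ring.
rewrite (le_trans (ler_normD _ _))//.
have := normr_dot_le (w - x) h.
have : `|w - x| * `|h| <= d * `|h| by rewrite ler_wpM2r// ltW.
lra.
Qed.
End InnerProduct.

(** * Limits of real sequences *)

Section RealSequences.
Context {R : realType}.

(** If some neighbourhood [V] of [l] had a preimage outside [F], then [F] and the
    complement of that preimage would lie in a common ultrafilter, along which
    [f] avoids [V]. *)
Lemma cvg_ultra (I : Type) (X : topologicalType) (F : set_system I)
    (f : I -> X) (l : X) : Filter F ->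
  (forall U, UltraFilter U -> F `<=` U -> f @ U --> l) -> f @ F --> l.
Proof.
move=> FF ultra V lV; apply/not_notP => FnV; pose N := ~` (f @^-1` V).
have NP : ProperFilter (within N F).
  split; last exact: within_filter.
  move=> N0; apply: FnV; suff : F (f @^-1` V) by [].
  by apply: (@filterS _ F _ _ _ _ N0) => i iN; apply/not_notP => /iN.
have [U [UU NU]] := ultraFilterLemma NP.
have FU : F `<=` U by move=> A FA; apply: NU; exact: filterS FA.
have UN : U N by apply: NU; exact: withinT.
have UV : U (f @^-1` V) by exact: ultra UU FU _ lV.
by have [i []] := filter_ex (filterI UN UV).
Qed.

(** Subtracting the partial sums of the errors [c] from [d] gives a
    nonincreasing sequence that is bounded below. *)
Lemma quasi_decreasing_cvg (d c : R^nat) (Q : R) :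
  (forall n, 0 <= d n) -> (forall n, 0 <= c n) ->
  (forall n, \sum_(0 <= k < n) c k <= Q) ->
  (forall n, d n.+1 <= d n + c n) -> cvgn d.
Proof.
move=> d0 c0 cQ dc; pose s n := \sum_(0 <= k < n) c k.
have s_cvg : cvgn s.
  apply: nondecreasing_is_cvgn; last by exists Q => _ [n _ <-]; exact: cQ.
  apply/nondecreasing_seqP => n.
  by rewrite /s big_nat_recr//= lerDl.
have ds_cvg : cvgn (d \- s).
  apply: nonincreasing_is_cvgn.
    apply/nonincreasing_seqP => n /=.
    by rewrite /s big_nat_recr//= opprD addrA addrAC lerB// lerBlDr.
  exists (- Q) => _ [n _ <-] /=.
  by rewrite lerNl opprB lerBlDr (le_trans (cQ n))// lerDl.
have -> : d = (d \- s) \+ s by apply/funext => n /=; rewrite subrK.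
exact: is_cvgD.
Qed.

(** The terms before a fixed rank carry a bounded total, which the divergent sum
    of the weights makes negligible; the later terms are all close to [c]. *)
Lemma weighted_mean_cvg (lam s : R^nat) (c : R) : (forall n, 0 < lam n) ->
  \sum_(1 <= k < n.+1) lam k @[n --> \oo] --> +oo ->
  s @ \oo --> c ->
  (\sum_(1 <= k < n.+1) lam k)^-1 * (\sum_(1 <= k < n.+1) lam k * s k)
    @[n --> \oo] --> c.
Proof.
move=> lam0 sig_oo sc; apply/cvgrPdist_le => e e0.
have e20 : 0 < e / 2 by rewrite divr_gt0.
have /cvgrPdist_le/(_ _ e20)[N _ sN] := sc.
pose K := \sum_(1 <= k < N.+1) lam k * `|c - s k|.
have K0 : 0 <= K by apply: sumr_ge0 => k _; rewrite mulr_ge0// ltW.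
have /cvgryPge/(_ (K / (e / 2) + 1)) sigK := sig_oo.
near=> n.
have Nn : (N <= n)%N by near: n; exact: nbhs_infty_ge.
have sig_ge : K / (e / 2) + 1 <= \sum_(1 <= k < n.+1) lam k by near: n.
set sig := \sum_(1 <= k < n.+1) lam k in sig_ge *.
have sig_gt0 : 0 < sig.
  by rewrite (lt_le_trans _ sig_ge)// ltr_wpDl// divr_ge0// ltW.
have -> : c - sig^-1 * (\sum_(1 <= k < n.+1) lam k * s k) =
    sig^-1 * \sum_(1 <= k < n.+1) lam k * (c - s k).
  under [in RHS]eq_bigr do rewrite mulrBr.
  rewrite sumrB -mulr_suml -/sig; field; exact: lt0r_neq0.
rewrite normrM gtr0_norm ?invr_gt0// ler_pdivrMl//.
apply: (le_trans (ler_norm_sum _ _ _)).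
rewrite (@big_cat_nat _ _ _ N.+1)//=.
have -> : sig * e = sig * (e / 2) + sig * (e / 2) by field.
apply: lerD.
  apply: (@le_trans _ _ K).
    by apply: ler_sum => k _; rewrite normrM gtr0_norm.
  rewrite -ler_pdivrMr//; apply: le_trans sig_ge; by rewrite lerDl.
rewrite /sig mulr_suml [leRHS](@big_cat_nat _ _ _ N.+1)//= ler_wpDl//.
  by apply: sumr_ge0 => k _; rewrite mulr_ge0 ?ltW.
rewrite big_nat_cond [leRHS]big_nat_cond; apply: ler_sum => k.
rewrite andbT => /andP[Nk _].
rewrite normrM gtr0_norm//; apply: ler_wpM2l; first exact: ltW.
exact: (sN _ (ltnW Nk)).
Unshelve. all: by end_near. Qed.

End RealSequences.

(** * Weak limits of bounded sequences *)

Section WeakLimits.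
Context {R : realType} {H : completeNormedModType R}.
Variables (dot : {dot H for @idfun R}) (hilbert : norm_of_dot dot).

(** This is weak compactness of balls: along an ultrafilter the bounded real
    numbers [dot (y i) h] converge for every [h], and their limit is a bounded
    linear functional of [h]. *)
Lemma weak_ultralimit (I : Type) (U : set_system I) (y : I -> H) (C : R) :
  UltraFilter U -> (forall i, `|y i| <= C) ->
  exists w, forall h, dot (y i) h @[i --> U] --> dot w h.
Proof.
move=> UU yC.
have bnd h i : `|dot (y i) h| <= C * `|h|.
  by rewrite (le_trans (normr_dot_le hilbert _ _))// ler_wpM2r.
have /boolp.choice[f fP] :
    forall h, exists c : R, dot (y i) h @[i --> U] --> c.
  move=> h.
  have : ProperFilter (dot (y i) h @[i --> U]) by exact: fmap_proper_filter.
  move=> G.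
  have : cluster (dot (y i) h @[i --> U]) !=set0.
    have [|c [_ cP]] := @segment_compact R (- (C * `|h|)) (C * `|h|) _ G.
      apply: (@filterS _ U _ setT) filterT => i _ /=.
      by rewrite in_itv/= -ler_norml.
    by exists c.
  move=> [c cP]; exists c => V cV.
  have [//|UnV] := in_ultra_setVsetC (fun i => V (dot (y i) h)) UU.
  by have [r []] := cP (~` V) V UnV cV.
have dotr_uniq (c d : R) (g : I -> R) : g @ U --> c -> g @ U --> d -> c = d.
  by move=> gc gd; apply: (cvg_unique (@norm_hausdorff _ _) gc gd).
have [|||w wP] := @riesz_representation _ _ dot hilbert f C.
- move=> a b; apply: (dotr_uniq _ _ _ (fP (a + b))).
  under eq_fun do rewrite linearDr/=; exact: cvgD.
- move=> c a; apply: (dotr_uniq _ _ _ (fP (c *: a))).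
  under eq_fun do rewrite dotZr; exact: cvgMr.
- move=> h; apply: (@cvgr_to_le _ U _ _ _ _ _ (cvg_norm (fP h))).
  exact: nearW.
- by exists w => h; rewrite -wP; exact: fP.
Qed.

(** Opial's argument. If [l] and [l'] are weak limits along two ultrafilters,
    then the convergence of [dot (y n) (l - l')] gives
    [dot l (l - l') = dot l' (l - l')], that is [l = l']; and a sequence that has
    the same limit along all ultrafilters converges. *)
Lemma weak_cvg_of_unique_ultralimits (S : set H) (y : nat -> H) (C : R) :
  (forall n, `|y n| <= C) ->
  (forall U w, UltraFilter U -> \oo `<=` U ->
     (forall h, dot (y n) h @[n --> U] --> dot w h) -> S w) ->
  (forall z1 z2, S z1 -> S z2 -> cvg (dot (y n) (z1 - z2) @[n --> \oo])) ->
  exists2 l, S l & converges_weakly_to y l.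
Proof.
move=> yC yS ySS.
have lim U : UltraFilter U -> \oo `<=` U ->
    exists2 w, S w & forall h, dot (y n) h @[n --> U] --> dot w h.
  move=> UU oU; have [w wP] := weak_ultralimit UU yC.
  by exists w => //; exact: yS UU oU wP.
have [U [UU oU]] := ultraFilterLemma eventually_filter.
have [l Sl lP] := lim U UU oU; exists l => // f fc.
have /linear_bounded_continuous/linear_boundedP := fc.
move=> /filter_ex[r fr].
have [||//|w wP] := @riesz_representation _ _ dot hilbert f r.
- exact: linearD.
- by move=> c h; rewrite linearZ.
rewrite wP dotC.
under eq_fun do rewrite wP dotC.
apply: cvg_ultra => V VU oV.
have [l' Sl' l'P] := lim V VU oV.
suff -> : l = l' by exact: l'P.
have /cvg_ex[c cP] := ySS _ _ Sl Sl'.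
have lc : dot l (l - l') = c.
  apply: (cvg_unique (@norm_hausdorff _ _) (lP (l - l'))).
  by move=> W cW; apply: oU; exact: cP.
have l'c : dot l' (l - l') = c.
  apply: (cvg_unique (@norm_hausdorff _ _) (l'P (l - l'))).
  by move=> W cW; apply: oV; exact: cP.
apply/eqP; rewrite -subr_eq0 -normr_eq0 -sqrf_eq0.
by rewrite (sqr_norm_dot hilbert) linearBl/= lc l'c subrr.
Qed.

End WeakLimits.

(** * Maximal monotone operators and their enlargements *)

Section MonotoneOperators.
Context {R : realType} {H : completeNormedModType R}.
Variables (dot : {dot H for @idfun R}) (hilbert : norm_of_dot dot).
Implicit Types (T A B : H -> set H) (x y z : H).

Lemma closure_dist_lt (X : set H) x (e : R) : closure X x -> 0 < e ->
  exists2 y, X y & `|x - y| < e.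
Proof.
move=> Xx e0; have [y []] := Xx _ (nbhsx_ballx x _ e0).
by rewrite -ball_normE/= => Xy xy; exists y.
Qed.

Lemma maximal_monotone_related T x u : maximal_monotone dot T ->
  (forall y v, T y v -> 0 <= dot (v - u) (y - x)) -> T x u.
Proof.
move=> [Tmon Tmax] Txu.
change (graph T (x, u)).
rewrite -(Tmax (graph T `|` [set (x, u)])); [by right| |by left].
move=> x1 u1 x2 u2 [T1|[-> ->]] [T2|[-> ->]].
- exact: Tmon.
- by rewrite -(opprB u1) -(opprB x1) linearNl linearNr/= opprK; exact: Txu.
- exact: Txu.
- by rewrite !subrr linear0l.
Qed.

(** By maximality, every pair [(z, w)] has some [(p, q)] in the graph of [B] with
    [dot (q - w) (p - z) <= 0]. Taking for [(z, w)] the midpoint of [(x, u)] and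
    [(y, v)], and adding the two enlargement inequalities at [(p, q)], gives the
    bound. *)
Lemma enlargement_almost_monotone B (e d : R) x u y v :
  maximal_monotone dot B -> enlargement dot B e x u ->
  enlargement dot B d y v -> - (2 * (e + d)) <= dot (u - v) (x - y).
Proof.
move=> Bmax Bxu Byv; pose z := 2^-1 *: (x + y); pose w := 2^-1 *: (u + v).
have [p [q [Bpq pq]]] : exists p q, B p q /\ dot (q - w) (p - z) <= 0.
  apply/not_notP => no; have Bzw : B z w.
    apply: maximal_monotone_related => // p q Bpq; rewrite leNgt.
    by apply/negP => /ltW pq; apply: no; exists p, q.
  (* The pair (z, w) is then itself a witness. *)
  by apply: no; exists z, w; rewrite !subrr linear0l.
have := Bxu p q Bpq; have := Byv p q Bpq; move: pq.
rewrite /z /w !dotE.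
lra.
Qed.

(** Here [p] is the element of [A x'] selected by the resolvent. Expanding the
    square of [x' - y = x - y - lam *: (p + u)] and using the definition of
    [A^d] for [p] and almost monotonicity of [B] for [u] leaves the error
    [lam ^+ 2 * (`|p + u| ^+ 2 - 2 * dot (p - a) (p + u))], which equals
    [lam ^+ 2 * (`|u + a| ^+ 2 - `|p - a| ^+ 2)]. Its part in [p] is nonpositive,
    so the unknown [p] disappears from the bound. *)
Lemma forward_backward_step A B (lam e d : R) x x' u y a b :
  maximal_monotone dot B -> 0 < lam ->
  enlargement dot B e x u -> resolvent A lam (x - lam *: u) x' ->
  enlargement dot A d y a -> enlargement dot B d y b ->
  `|x' - y| ^+ 2 <= `|x - y| ^+ 2 - 2 * lam * dot (a + b) (x - y)
    + lam ^+ 2 * `|u + a| ^+ 2 + lam * (4 * e + 6 * d).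
Proof.
move=> Bmax lam0 Bxu [p Ap x'E] Aya Byb.
have Apa := Aya _ _ Ap; have Bub : - (2 * (e + d)) <= dot (u - b) (x - y).
  exact: enlargement_almost_monotone Bmax Bxu Byb.
have x'yE : x' - y = (x - y) - lam *: (p + u).
  have -> : x' = x - lam *: u - lam *: p by rewrite -x'E addrK.
  by rewrite scalerDr opprD addrA [LHS]addrAC (addrAC x) [RHS]addrAC.
move: Apa; rewrite x'yE => Apa.
have sq0 := sqr_ge0 `|p - a|.
move: (x - y) Apa Bub sq0 => X.
rewrite (sqr_normB hilbert) normrZ exprMn (gtr0_norm lam0).
rewrite !(sqr_norm_dot hilbert) !dotE (dotC dot u p) (dotC dot a p).
rewrite (dotC dot a u) (dotC dot X p) (dotC dot X u).
move=> /(ler_wpM2l (ltW lam0)) + /(ler_wpM2l (ltW lam0)) +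
  /(ler_wpM2l (sqr_ge0 lam)).
lra.
Qed.

End MonotoneOperators.

(** * Weighted averages *)

Section WeightedAverages.
Context {R : realType} {H : completeNormedModType R}.
Variables (dot : {dot H for @idfun R}).
Variables (lam : R^nat) (x : nat -> H).

Lemma dot_weighted_average n h : dot (weighted_average lam x n) h =
  (\sum_(1 <= k < n.+1) lam k)^-1 * \sum_(1 <= k < n.+1) lam k * dot (x k) h.
Proof.
rewrite /weighted_average dotZl; congr (_ * _).
rewrite (big_morph (dot^~ h) (fun a b => dotDl dot a b h) (linear0l dot h)).
by apply: eq_bigr => k _; rewrite dotZl.
Qed.

Lemma norm_weighted_average_le (C : R) n : (forall k, 0 < lam k) ->
  (forall k, `|x k| <= C) -> `|weighted_average lam x n| <= C.
Proof.
move=> lam_gt0 xC; have C0 := le_trans (normr_ge0 (x 0%N)) (xC 0%N).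
have s0 : 0 <= \sum_(1 <= k < n.+1) lam k by apply: sumr_ge0 => k _; exact: ltW.
rewrite /weighted_average normrZ ger0_norm ?invr_ge0//.
(* For n = 0 the sum of the weights and its inverse are 0. *)
move: s0; rewrite le_eqVlt => /orP[/eqP<-|s0]; first by rewrite invr0 mul0r.
rewrite ler_pdivrMl// (le_trans (ler_norm_sum _ _ _))// mulr_suml.
by apply: ler_sum => k _; rewrite normrZ gtr0_norm// ler_pM2l.
Qed.

End WeightedAverages.

(** * The extended forward-backward iteration *)

Section ForwardBackward.
Context {R : realType} {H : completeNormedModType R}.
Variables (dot : {dot H for @idfun R}) (hilbert : norm_of_dot dot).
Variables (A B : H -> set H) (B_max : maximal_monotone dot B).
Variables (lam eps : R^nat) (x u : nat -> H) (C : R).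
Hypothesis eps_gt0 : forall n, 0 < eps n.
Hypothesis lamE : forall n, lam n = eps n ^+ 3.
Hypothesis u_step : forall n, enlargement dot B (eps n) (x n) (u n).
Hypothesis x_step :
  forall n, resolvent A (lam n) (x n - lam n *: u n) (x n.+1).
Hypothesis uC : forall n, `|eps n *: u n| <= C.

Let lam_gt0 n : 0 < lam n. Proof. by rewrite lamE exprn_gt0. Qed.

(** With [lam n = eps n ^+ 3] and [eps n *: u n] bounded, the quadratic error
    [lam n ^+ 2 * `|u n + a| ^+ 2] and the enlargement error [lam n * eps n] are
    both of the summable order [eps n ^+ 4]. *)
Lemma sqr_dist_step n (d r : R) y a b :
  enlargement dot A d y a -> enlargement dot B d y b -> eps n * `|a| <= r ->
  `|x n.+1 - y| ^+ 2 <= `|x n - y| ^+ 2 - 2 * lam n * dot (a + b) (x n - y)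
    + eps n ^+ 4 * ((C + r) ^+ 2 + 4) + 6 * d * lam n.
Proof.
move=> Aa Bb ar.
have := forward_backward_step hilbert B_max (lam_gt0 n)
  (u_step n) (x_step n) Aa Bb.
have uaC : eps n * `|u n + a| <= C + r.
  rewrite -{1}(gtr0_norm (eps_gt0 n)) -normrZ scalerDr.
  rewrite (le_trans (ler_normD _ _))// lerD//.
  by rewrite normrZ gtr0_norm.
have : (eps n * `|u n + a|) ^+ 2 <= (C + r) ^+ 2.
  by rewrite ler_pXn2r// nnegrE ?(le_trans _ uaC) ?mulr_ge0// ltW.
have e4 : 0 <= eps n ^+ 4 by rewrite exprn_ge0// ltW.
move=> /(ler_wpM2l e4).
rewrite lamE exprMn; lra.
Qed.

(** The sum [a + b] can be taken so small that its inner product with [x n - z] is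
    of order [eps n]. As [b] is at most [M / eps n] in norm, [a] is at most twice
    that. *)
Lemma quasi_fejer n z (M : R) : 0 < M ->
  closure (minkowski_sum (enlargement dot A (eps n) z)
    (enlargement dot B (eps n) z `&` scaled_unit_ball (M / eps n))) 0 ->
  `|x n.+1 - z| ^+ 2 <=
  `|x n - z| ^+ 2 + ((C + 2 * M) ^+ 2 + 11) * eps n ^+ 4.
Proof.
move=> M0 clz; pose X := `|x n - z|.
have X1 : 0 < X + 1 by rewrite /X ltr_wpDl.
(* The first bound on d controls the inner product with x n - z, the second one
   the norm of a. *)
pose d := Num.min (eps n / (2 * (X + 1))) (M / eps n).
have d0 : 0 < d by rewrite lt_min !divr_gt0// mulr_gt0.
have [_ [a Aa [b [Bb [w w1 wb]] <-]]] := closure_dist_lt clz d0.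
rewrite sub0r normrN => abd.
have e0 := eps_gt0 n.
have aM : eps n * `|a| <= 2 * M.
  have -> : a = (a + b) - b by rewrite addrK.
  have /(ler_wpM2l (ltW e0)) := ler_normB (a + b) b.
  have : eps n * `|b| <= M.
    rewrite -wb normrZ gtr0_norm ?divr_gt0// mulrA (mulrC (eps n)).
    rewrite divfK ?gt_eqF//.
    by rewrite ger_pMr.
  have : eps n * `|a + b| <= M.
    rewrite -ler_pdivlMl// mulrC (le_trans (ltW abd))//.
    by rewrite /d ge_min lexx orbT.
  lra.
have := sqr_dist_step Aa Bb aM.
have abX : - (eps n / 2) <= dot (a + b) (x n - z).
  have := normr_dot_le hilbert (a + b) (x n - z).
  rewrite ler_norml => /andP[+ _].
  apply: le_trans; rewrite lerN2.
  have h1 : d <= eps n / (2 * (X + 1)) by rewrite ge_min lexx.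
  have h2 : d * (X + 1) <= eps n / 2.
    by rewrite -ler_pdivlMr// -mulrA -invfM mulrC// mulrC.
  apply: (le_trans _ h2); apply: ler_pM => //; first exact: ltW.
  by rewrite lerDl.
have /(ler_wpM2l (ltW (lam_gt0 n))) := abX.
rewrite lamE; lra.
Qed.

Variable Q : R.
Hypothesis epsQ : forall n, \sum_(0 <= k < n) eps k ^+ 4 <= Q.
Hypothesis lam_oo : \sum_(1 <= k < n.+1) lam k @[n --> \oo] --> +oo.

(** Approximating [v] by [a + b] with [a] and [b] in the [d]-enlargements, the
    steps telescope: after division by the sum of the weights, the initial
    distance and the summable errors vanish, and what remains is of order [d]. *)
Lemma weighted_average_related y v (D : R) : extended_sum dot A B y v ->
  (forall n, `|x n - y| <= D) -> forall r, 0 < r ->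
  \forall n \near \oo, dot v (weighted_average lam x n - y) <= r.
Proof.
move=> yv xD r r0.
have D0 : 0 <= D := le_trans (normr_ge0 _) (xD 0%N).
pose d := r / (D + 4).
have d0 : 0 < d by rewrite divr_gt0// ltr_wpDl.
have [_ [a Aa [b Bb <-]] abd] := closure_dist_lt (yv d d0) d0.
have Q0 : 0 <= Q by have := epsQ 0; rewrite big_geq.
have epsQ1 n : eps n <= Q + 1.
  have [e1|e1] := leP (eps n) 1; first by rewrite (le_trans e1)// lerDr.
  apply: (@le_trans _ _ (eps n ^+ 4)); first by rewrite ler_eXnr// ltW.
  apply: (@le_trans _ _ Q); last by rewrite lerDl.
  apply: le_trans (epsQ n.+1); rewrite big_nat_recr//= lerDr.
  by apply: sumr_ge0 => k _; rewrite exprn_ge0// ltW.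
pose K := (C + (Q + 1) * `|a|) ^+ 2 + 4.
have K0 : 0 <= K by rewrite addr_ge0// sqr_ge0.
have step k : lam k * (2 * dot v (x k - y)) <=
    (`|x k - y| ^+ 2 - `|x k.+1 - y| ^+ 2) + K * eps k ^+ 4
    + lam k * (2 * d * D + 6 * d).
  have ak : eps k * `|a| <= (Q + 1) * `|a| by rewrite ler_wpM2r.
  have := sqr_dist_step Aa Bb ak.
  have -> : dot v (x k - y) =
      dot (v - (a + b)) (x k - y) + dot (a + b) (x k - y).
    by rewrite dotBl subrK.
  have : dot (v - (a + b)) (x k - y) <= d * D.
    rewrite (le_trans (dot_le_norm hilbert _ _))//.
    by apply: ler_pM => //; exact: ltW.
  move=> /(ler_wpM2l (ltW (lam_gt0 k))); rewrite /K; lra.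
have /cvgryPge/(_ ((D ^+ 2 + K * Q) / d + 1)) sig_large := lam_oo.
near=> n.
have : (D ^+ 2 + K * Q) / d + 1 <= \sum_(1 <= k < n.+1) lam k.
  by near: n.
rewrite dotBr (dotC dot v (weighted_average _ _ _)) dot_weighted_average.
set sig := \sum_(1 <= k < n.+1) lam k => sig_ge.
have DKQ : 0 <= D ^+ 2 + K * Q by rewrite addr_ge0 ?sqr_ge0 ?mulr_ge0.
have sig0 : 0 < sig.
  by rewrite (lt_le_trans _ sig_ge)// ltr_wpDl// divr_ge0// ltW.
have sigd : D ^+ 2 + K * Q <= sig * d.
  by rewrite -ler_pdivrMr// (le_trans _ sig_ge)// lerDl.
have : \sum_(1 <= k < n.+1) lam k * (2 * dot v (x k - y)) <=
    D ^+ 2 + K * Q + sig * (2 * d * D + 6 * d).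
  apply: le_trans (ler_sum _ (fun k _ => step k)) _.
  rewrite !big_split/= -mulr_suml -/sig lerD2r -mulr_sumr; apply: lerD.
    rewrite -big_split/=.
    rewrite (eq_bigr (fun k => - (`|x k.+1 - y| ^+ 2 - `|x k - y| ^+ 2)));
      last by move=> k _; rewrite opprB.
    rewrite sumrN (telescope_sumr (fun k => `|x k - y| ^+ 2))// opprB.
    rewrite lerBlDr ler_wpDr ?sqr_ge0//.
    by rewrite ler_pXn2r// nnegrE.
  rewrite ler_wpM2l//; apply: le_trans (epsQ n.+1).
  by rewrite [leRHS]big_ltn// lerDr exprn_ge0// ltW.
have -> : \sum_(1 <= k < n.+1) lam k * (2 * dot v (x k - y)) =
   2 * sig * (sig^-1 * (\sum_(1 <= k < n.+1) lam k * dot (x k) v) - dot v y).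
  rewrite mulrBr mulrA -(mulrA 2) divff ?gt_eqF// mulr1 mulr_sumr.
  rewrite mulrAC (mulrC _ sig) /sig mulr_suml -sumrB; apply: eq_bigr => k _.
  by rewrite dotBr (dotC dot v (x k)); ring.
move: (_ - dot v y) => t h.
have : 2 * sig * t <= sig * (2 * r).
  apply: (le_trans h).
  have -> : r = d * (D + 4) by rewrite /d divfK// gt_eqF// ltr_wpDl.
  have := mulr_gt0 sig0 d0; lra.
by rewrite -mulrA mulrCA ler_pM2l// ler_pM2l.
Unshelve. all: by end_near. Qed.

End ForwardBackward.

(** * Weak convergence of the averages *)

Lemma bounded_fun_norm_le {R : realType} {V : normedModType R} {I : Type}
  (f : I -> V) : bounded_fun f -> exists C, forall i, `|f i| <= C.
Proof.
move=> [C [_ fC]]; exists (C + 1) => i.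
by apply: (fC (C + 1)) => //; rewrite ltrDl.
Qed.

Lemma partial_sums_le {R : realType} (c : R^nat) : (forall n, 0 <= c n) ->
  (\sum_(0 <= n <oo) (c n)%:E < +oo)%E ->
  exists Q, forall n, \sum_(0 <= k < n) c k <= Q.
Proof.
move=> c0 c_oo; set s : \bar R := (\sum_(0 <= n <oo) (c n)%:E)%E in c_oo.
exists (fine s) => n.
have s0 : (0 <= s)%E by apply: nneseries_ge0 => k _ _; rewrite lee_fin.
rewrite -lee_fin fineK ?ge0_fin_numE// -sumEFin nneseries_lim_ge// => k _ _.
by rewrite lee_fin.
Qed.

Lemma partial_sums_dvg {R : realType} (c : R^nat) : (forall n, 0 <= c n) ->
  (\sum_(0 <= n <oo) (c n)%:E = +oo)%E ->
  \sum_(1 <= k < n.+1) c k @[n --> \oo] --> +oo.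
Proof.
move=> c0 c_oo; apply/cvgryPge => K.
have : (\sum_(0 <= k < n) (c k)%:E)%E @[n --> \oo] --> +oo%E.
  rewrite -c_oo; apply: is_cvg_nneseries => k _ _; by rewrite lee_fin.
move=> /cvgeyPge/(_ (K + c 0%N))[N _ NK]; exists N => // n /= Nn.
have := NK n.+1 (leqW Nn); rewrite /= sumEFin lee_fin.
by rewrite (@big_ltn _ _ _ 0%N n.+1)// (addrC K) lerD2l.
Qed.

Theorem theorem3p1 (R : realType) (H : completeNormedModType R)
    (dot : {dot H for @idfun R}) (hilbert : norm_of_dot dot)
    (A B : H -> set H)
    (A_max : maximal_monotone dot A) (B_max : maximal_monotone dot B)
    (T : H -> set H)
    (T_def : forall x : H, T x = extended_sum dot A B x)
    (T_max : maximal_monotone dot T)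
    (S_nonempty : zeros T !=set0)
    (domain_incl : domain A `<=`
       \bigcap_(e in [set e : R | 0 < e]) domain (enlargement dot B e))
    (lam eps : nat -> R)
    (lam_gt0 : forall n : nat, 0 < lam n)
    (eps_gt0 : forall n : nat, 0 < eps n)
    (lam_sum : (\sum_(0 <= n <oo) (lam n)%:E = +oo)%E)
    (lam43_sum : (\sum_(0 <= n <oo) (lam n `^ (4 / 3))%:E < +oo)%E)
    (eps_def : forall n : nat, eps n = lam n `^ (1 / 3))
    (x u : nat -> H)
    (x0_dom : domain (enlargement dot B (eps 0%N)) (x 0%N))
    (u_step : forall n : nat, enlargement dot B (eps n) (x n) (u n))
    (x_step : forall n : nat,
       resolvent A (lam n) (x n - lam n *: u n) (x n.+1))
    (u_bounded : bounded_fun (fun n : nat => eps n *: u n))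
    (zeros_approx : forall z : H, zeros T z ->
       exists2 M : R, 0 < M &
         (\bigcap_(n in [set: nat])
           closure (minkowski_sum (enlargement dot A (eps n) z)
             (enlargement dot B (eps n) z `&` scaled_unit_ball (M / eps n))))
         0) :
  exists2 l : H, zeros T l & converges_weakly_to (weighted_average lam x) l.
Proof.
have epsX k n : eps n ^+ k = lam n `^ (k%:R / 3).
  by rewrite eps_def -powR_mulrn ?powR_ge0// -powRrM mulrAC mul1r.
have lamE n : lam n = eps n ^+ 3 by rewrite epsX divff// powRr1// ltW.
have eps4_ge0 n : 0 <= eps n ^+ 4 by rewrite exprn_ge0// ltW.
have [Q epsQ] : exists Q, forall n, \sum_(0 <= k < n) eps k ^+ 4 <= Q.
  apply: partial_sums_le => //.
  by under eq_eseriesr do rewrite epsX.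
have lam_oo : \sum_(1 <= k < n.+1) lam k @[n --> \oo] --> +oo.
  by apply: partial_sums_dvg => // n; exact: ltW.
have [C uC] : exists C, forall n, `|eps n *: u n| <= C.
  exact: bounded_fun_norm_le u_bounded.
have dist_cvg z : zeros T z -> cvgn (fun n => `|x n - z| ^+ 2).
  move=> /zeros_approx[M M0 clM]; pose K := (C + 2 * M) ^+ 2 + 11.
  have K0 : 0 <= K by rewrite addr_ge0// sqr_ge0.
  apply: (@quasi_decreasing_cvg R _ (fun n => K * eps n ^+ 4) (K * Q)) => n.
  - exact: sqr_ge0.
  - exact: mulr_ge0.
  - by rewrite -mulr_sumr ler_wpM2l.
  - exact: (quasi_fejer hilbert B_max eps_gt0 lamE u_step x_step uC M0
      (clM n I)).
have x_bounded y : exists D, forall n, `|x n - y| <= D.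
  have [z Sz] := S_nonempty.
  have [D xD] := bounded_fun_norm_le (cvg_seq_bounded (dist_cvg z Sz)).
  exists (D + 1 + `|z - y|) => n.
  have -> : x n - y = (x n - z) + (z - y) by rewrite addrA subrK.
  rewrite (le_trans (ler_normD _ _))// lerD2r.
  have := xD n; rewrite ger0_norm ?sqr_ge0//.
  (* The bound `|x n - z| <= `|x n - z| ^+ 2 + 1. *)
  have := sqr_ge0 (`|x n - z| - 1); nra.
have [D xD] := x_bounded 0.
apply: (weak_cvg_of_unique_ultralimits hilbert (C := D)).
- move=> n; apply: norm_weighted_average_le => // k.
  by rewrite -(subr0 (x k)).
(* Weak limits of the averages are zeros of T, by maximality of T. *)
- move=> U w UU oU wP; apply: (maximal_monotone_related T_max) => y v Tyv.
  rewrite subr0 -oppr_le0 -linearNr/= opprB; apply/ler_addgt0Pl => r r0.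
  rewrite addr0.
  have [Dy xDy] := x_bounded y.
  have vlim : dot v (weighted_average lam x n - y) @[n --> U] --> dot v (w - y).
    rewrite dotBr dotC; under eq_fun do rewrite dotBr dotC.
    by apply: cvgB; [exact: wP|exact: cvg_cst].
  apply: (cvgr_to_le vlim); apply: oU.
  rewrite T_def in Tyv.
  exact: (weighted_average_related hilbert B_max eps_gt0 lamE u_step x_step uC
    epsQ lam_oo Tyv xDy).
(* By polarisation, the convergence of the distances to z1 and z2 gives that of
   the inner products with z1 - z2, and averaging preserves limits. *)
- move=> z1 z2 Sz1 Sz2.
  have : cvgn (fun n => dot (x n) (z1 - z2)).
    have -> : (fun n => dot (x n) (z1 - z2)) = (fun n => 2^-1 *
        (`|x n - z2| ^+ 2 - `|x n - z1| ^+ 2 + (`|z1| ^+ 2 - `|z2| ^+ 2))).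
      by apply/funext => n; rewrite !(sqr_normB hilbert) dotBr; field.
    apply: is_cvgMr; apply: is_cvgD; last exact: is_cvg_cst.
    by apply: is_cvgB; exact: dist_cvg.
  move=> /cvg_ex[c xc]; apply/cvg_ex; exists c.
  under eq_fun do rewrite dot_weighted_average.
  exact: weighted_mean_cvg.
Qed.
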